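(* Let $2n=4$, let the ambient metric be Euclidean, $\eta_{ab}=\delta_{ab}$, and let $\theta^{\mu\nu}$ be a real non-degenerate Poisson tensor on the embedded manifold $\mathcal{M}^4\subset\mathbb{R}^D$ with induced metric $g_{\mu\nu}$, with $G^{\mu\nu}$, $\sigma$ and $\eta$ defined as in the context. Then at every point of $\mathcal{M}^4$ $$e^{-\sigma}\eta=\tfrac14\,G^{\mu\nu}g_{\mu\nu}\;\ge\;1,$$ and the minimal value $e^{-\sigma}\eta=1$ is assumed at a point if and only if $G_{\mu\nu}=g_{\mu\nu}$ there, equivalently if and only if the symplectic form $\omega=\frac12\theta^{-1}_{\mu\nu}dx^\mu\wedge dx^\nu$ satisfies $\star\omega=\pm\omega$ there. Consequently, for a fixed embedding $\mathcal{M}^4\subset\mathbb{R}^D$, the minimum of the semi-classical Yang-Mills action $$S_{YM}=\int\frac{d^4x}{(2\pi)^2}\sqrt{|G|}\;e^{-\sigma}\eta$$ is achieved if $\theta^{\mu\nu}$ is self-dual or anti-self-dual with respect to $g_{\mu\nu}$, i.e. if $G_{\mu\nu}=g_{\mu\nu}$.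
   Context: Let $x^a:\mathcal{M}^4\hookrightarrow\mathbb{R}^D$, $a=1,\dots,D$, be the Cartesian embedding functions of an oriented 4-dimensional submanifold of flat $\mathbb{R}^D$ with metric $\eta_{ab}$. The induced metric is $g_{\mu\nu}=\partial_\mu x^a\partial_\nu x^b\eta_{ab}$. $\theta^{\mu\nu}$ is a non-degenerate Poisson tensor on $\mathcal{M}^4$; its inverse matrix $\theta^{-1}_{\mu\nu}$ is a symplectic form. The effective metric $G_{\mu\nu}$ (with inverse $G^{\mu\nu}$) and the function $\sigma$ are defined by $$G^{\mu\nu}=e^{-\sigma}\theta^{\mu\rho}\theta^{\nu\kappa}g_{\rho\kappa},\qquad e^{-\sigma}=\frac{\rho}{\sqrt{\det G_{\mu\nu}}},\qquad \rho=\sqrt{\det\theta^{-1}_{\mu\nu}},$$ which determine $\sigma$ uniquely; in dimension 4 one has $|G|:=\det G_{\mu\nu}=\det g_{\mu\nu}$. Furthermore $\eta=\frac14e^\sigma G^{\mu\nu}g_{\mu\nu}$. $\star$ is the Hodge star of $g_{\mu\nu}$; $\theta$ is called (anti-)self-dual with respect to $g$ if $\star\omega=\omega$ (resp. $\star\omega=-\omega$). The action $S_{YM}$ is the semi-classical limit of the matrix model action $-\frac14\mathrm{Tr}([X^a,X^b][X_a,X_b])$, obtained by replacing commutators by $i$ times Poisson brackets and $\mathrm{Tr}$ by $\int\frac{d^4x}{(2\pi)^2}\sqrt{|G|}\,e^{-\sigma}$. *)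

(* Defs.v *)
From mathcomp Require Import all_boot all_order all_fingroup all_algebra.
From mathcomp Require Import all_classical all_reals all_analysis.

Set Implicit Arguments.
Unset Strict Implicit.
Unset Printing Implicit Defensive.

Import Order.TTheory GRing.Theory Num.Theory.
Import numFieldNormedType.Exports.

Local Open Scope classical_set_scope.
Local Open Scope ring_scope.

Section Calculus.
Variable R : realType.

Definition partial (n : nat) (V : normedModType R) (mu : 'I_n)
    (f : 'rV[R]_n -> V) : 'rV[R]_n -> V :=
  fun u => 'D_(delta_mx 0 mu) f u.

Definition iter_partial (n : nat) (V : normedModType R) (s : seq 'I_n)
    (f : 'rV[R]_n -> V) : 'rV[R]_n -> V :=
  foldr (@partial n V) f s.

(* C^oo on the open set U *)
Definition smooth_on (n : nat) (V : normedModType R) (U : set 'rV[R]_n)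
    (f : 'rV[R]_n -> V) : Prop :=
  forall (s : seq 'I_n) (u : 'rV[R]_n), U u ->
    differentiable (iter_partial s f) u.

(* Lebesgue measure d^4x. The analysis library has measures on products but
   not on row vectors, so R^4 is R * R * R * R for integration and [row4]
   translates to the coordinates 'rV_4 used everywhere else. *)
Definition lebesgue4 :=
  (((@lebesgue_measure R \x @lebesgue_measure R)
     \x @lebesgue_measure R) \x @lebesgue_measure R)%E.

Definition row4 (p : measurableTypeR R * measurableTypeR R *
    measurableTypeR R * measurableTypeR R) : 'rV[R]_4 :=
  let: (a, b, c, d) := p in \row_(i < 4) nth 0 [:: a; b; c; d] i.

End Calculus.

(* In the chart [i], [chart_emb i : chart_dom i -> R^D] gives the embedding functions x^a
   in the local coordinates x^mu. Countably many charts are no restriction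
   since a subspace of R^D is second countable; [chart_dom i] may be empty. *)
Record oriented_submanifold (R : realType) (D : nat) := OrientedSubmanifold {
  carrier : set 'rV[R]_D;
  chart_dom : nat -> set 'rV[R]_4;
  chart_emb : nat -> 'rV[R]_4 -> 'rV[R]_D;
  transition : nat -> nat -> 'rV[R]_4 -> 'rV[R]_4 :=
    fun i j u => get [set v | chart_dom j v /\ chart_emb j v = chart_emb i u];
  overlap : nat -> nat -> set 'rV[R]_4 :=
    fun i j => chart_dom i `&` chart_emb i @^-1` (chart_emb j @` chart_dom j);
  dom_open : forall i, open (chart_dom i);
  emb_smooth : forall i, smooth_on (chart_dom i) (chart_emb i);
  emb_immersion : forall i u, chart_dom i u -> \rank ('J (chart_emb i) u) = 4%N;
  emb_inj : forall i, {in chart_dom i &, injective (chart_emb i)};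
  (* [chart_emb i] is open as a map into [carrier] with the subspace topology *)
  emb_open : forall i (V : set 'rV[R]_4), open V -> V `<=` chart_dom i ->
    exists2 W : set 'rV[R]_D, open W & chart_emb i @` V = carrier `&` W;
  emb_cover : carrier = \bigcup_i (chart_emb i @` chart_dom i);
  emb_oriented : forall i j u, overlap i j u ->
    0 < \det ('J (transition i j) u)
}.

Section Fields.
Variables (R : realType) (D : nat) (M : oriented_submanifold R D).

(* Tensor fields on M are families, indexed by the charts, of functions giving
   the components in the local coordinates of that chart. *)
Definition mx_field := nat -> 'rV[R]_4 -> 'M[R]_4.
Definition scalar_field := nat -> 'rV[R]_4 -> R.

(* 'J row index = old coordinate, column index = new coordinate, so this is
   th'^(mu nu) = d_rho y^mu  d_kappa y^nu  th^(rho kappa). *)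
Definition contravariant2 (th : mx_field) : Prop :=
  forall i j u, overlap M i j u ->
    th j (transition M i j u) =
      ('J (transition M i j) u)^T *m th i u *m 'J (transition M i j) u.

Definition jacobi_identity (th : 'rV[R]_4 -> 'M[R]_4) (u : 'rV[R]_4) : Prop :=
  forall mu nu kappa : 'I_4,
    \sum_(l < 4) (th u mu l * (partial l th u) nu kappa
                + th u nu l * (partial l th u) kappa mu
                + th u kappa l * (partial l th u) mu nu) = 0.

Record nondegenerate_poisson (th : mx_field) : Prop := NondegeneratePoisson {
  poisson_tensor : contravariant2 th;
  poisson_smooth : forall i, smooth_on (chart_dom M i) (th i);
  poisson_anti : forall i u, chart_dom M i u -> (th i u)^T = - th i u;
  poisson_jacobi : forall i u, chart_dom M i u -> jacobi_identity (th i) u;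
  poisson_nondeg : forall i u, chart_dom M i u -> th i u \in unitmx
}.

(* g_(mu nu) = d_mu x^a d_nu x^b delta_(ab) *)
Definition induced_metric : mx_field := fun i u =>
  \matrix_(mu, nu) \sum_(a < D) \sum_(b < D)
    (partial mu (chart_emb M i) u) 0 a * (partial nu (chart_emb M i) u) 0 b * (a == b)%:R.

(* rho = sqrt (det theta^-1_(mu nu)) *)
Definition symplectic_density (th : 'M[R]_4) : R := Num.sqrt (\det (invmx th)).

(* G has lower indices; invmx G is G^(mu nu). *)
Definition is_effective_metric (g th G : 'M[R]_4) (sigma : R) : Prop :=
  [/\ G \in unitmx,
      forall mu nu, invmx G mu nu =
        expR (- sigma) * \sum_(r < 4) \sum_(k < 4) th mu r * th nu k * g r k
    & expR (- sigma) = symplectic_density th / Num.sqrt (\det G)].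

Definition effective_metric (th G : mx_field) (sigma : scalar_field) : Prop :=
  forall i u, chart_dom M i u ->
    is_effective_metric (induced_metric i u) (th i u) (G i u) (sigma i u).

(* G^(mu nu) g_(mu nu) *)
Definition mx_contract (G g : 'M[R]_4) : R :=
  \sum_(mu < 4) \sum_(nu < 4) invmx G mu nu * g mu nu.

Definition eta_fun (G : mx_field) (sigma : scalar_field) : scalar_field :=
  fun i u =>
    4^-1 * expR (sigma i u) * mx_contract (G i u) (induced_metric i u).

Definition levi_civita (mu nu r k : 'I_4) : R :=
  \sum_(s : 'S_4 | [tuple s i | i < 4] == [tuple mu; nu; r; k]) (-1) ^+ s.

(* Hodge star on 2-forms omega = 1/2 w_(mu nu) dx^mu /\ dx^nu, in positively
   oriented coordinates:
   ( *w)_(mu nu) = 1/2 sqrt|g| eps_(mu nu r k) g^(r a) g^(k b) w_(a b) *)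
Definition hodge2 (g w : 'M[R]_4) : 'M[R]_4 :=
  \matrix_(mu, nu) (2^-1 * Num.sqrt (\det g) *
    \sum_(r < 4) \sum_(k < 4) \sum_(a < 4) \sum_(b < 4)
      levi_civita mu nu r k * invmx g r a * invmx g k b * w a b).

(* Components theta^-1_(mu nu) of omega. *)
Definition symplectic_form (th : mx_field) : mx_field :=
  fun i u => invmx (th i u).

Definition self_dual_at (th : mx_field) (i : nat) (u : 'rV[R]_4) : Prop :=
  hodge2 (induced_metric i u) (symplectic_form th i u) =
  symplectic_form th i u.

Definition anti_self_dual_at (th : mx_field) (i : nat) (u : 'rV[R]_4) : Prop :=
  hodge2 (induced_metric i u) (symplectic_form th i u) =
  - symplectic_form th i u.

Definition poisson_bracket (th : mx_field) (i : nat) (f h : 'rV[R]_4 -> R) :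
    'rV[R]_4 -> R := fun u =>
  \sum_(mu < 4) \sum_(nu < 4) th i u mu nu * partial mu f u * partial nu h u.

(* The integral over M of d^4x f, for a scalar density f given in every chart:
   M is the disjoint union of the Borel sets chart_emb i (piece i), where piece i
   omits the points already covered by a chart of smaller index. *)
Definition piece (i : nat) : set 'rV[R]_4 :=
  [set u | chart_dom M i u /\
     forall j, (j < i)%N -> ~ (chart_emb M j @` chart_dom M j) (chart_emb M i u)].

Definition integral_density (f : scalar_field) : \bar R :=
  (\sum_(0 <= i <oo)
    \int[@lebesgue4 R]_(p in [set p | piece i (row4 p)]) (f i (row4 p))%:E)%E.

(* Semi-classical limit of Tr L. *)
Definition semiclassical_trace (G : mx_field) (sigma L : scalar_field) :
    \bar R :=
  integral_density (fun i u =>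
    ((2 * pi) ^+ 2)^-1 * Num.sqrt (\det (G i u)) * expR (- sigma i u) * L i u).

(* Semi-classical limit of - 1/4 [X^a, X^b] [X_a, X_b], where every [X^a, X^b]
   becomes i {x^a, x^b}; the sign is that of the two factors i. *)
Definition ym_lagrangian (th : mx_field) : scalar_field := fun i u =>
  4^-1 * \sum_(a < D) \sum_(b < D)
    poisson_bracket th i (fun v => chart_emb M i v 0 a) (fun v => chart_emb M i v 0 b) u
    ^+ 2.

Definition S_YM (th G : mx_field) (sigma : scalar_field) : \bar R :=
  semiclassical_trace G sigma (ym_lagrangian th).

End Fields.

(* Main.v *)
Require Import Defs.
From mathcomp Require Import all_boot all_order all_fingroup all_algebra.
From mathcomp Require Import all_classical all_reals all_analysis.
From mathcomp Require Import ring lra.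
Import Order.TTheory GRing.Theory Num.Theory.
Import numFieldNormedType.Exports.
Local Open Scope classical_set_scope.
Local Open Scope ring_scope.

Set Implicit Arguments.
Unset Strict Implicit.
Unset Printing Implicit Defensive.

(** Write c = e^-sigma. Taking determinants gives c^2 det(theta) det(g) = 1 and
    G^-1 = c theta g theta^T. With a factorisation g = P P^T and the antisymmetric
    matrix T = P^T theta P this reads (c Pf T)^2 = 1 and G^(mu nu) g_(mu nu) =
    c tr(T T^T), and tr(T T^T) - 4 |Pf T| is twice a sum of three squares which
    vanishes exactly when T T^T = |Pf T|, that is when G = g.
    The dual of an antisymmetric 4x4 matrix is a multiple of its inverse, so that
    *omega = +- c g theta g, while G = g means that c g theta g = - omega; the
    case c g theta g = omega is excluded because tr(g theta g theta) < 0. *)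

(** * Cholesky factorisation of positive definite matrices *)

Section Cholesky.
Variable F : rcfType.

Definition posdefmx n (g : 'M[F]_n) : Prop :=
  forall v : 'rV_n, v != 0 -> 0 < (v *m g *m v^T) 0 0.

(** Induction on the size: clearing the first row and column leaves the Schur complement [S], which
    is again symmetric and positive definite. *)
Lemma cholesky n (g : 'M[F]_n) :
  g^T = g -> posdefmx g -> exists P : 'M[F]_n, g = P *m P^T.
Proof.
elim: n g => [|n IHn] g gT gpos; first by exists 0; rewrite flatmx0 [RHS]flatmx0.
rewrite -[n.+1]/(1 + n)%N in g gT gpos *.
pose a := g 0 0; pose u := dlsubmx g; pose B := drsubmx g.
have gE : g = block_mx a%:M u^T u B.
  rewrite -[g in LHS]submxK; congr block_mx.
    by rewrite [LHS]mx11_scalar !mxE lshift0.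
  by rewrite /u trmx_dlsub gT.
have BT : B^T = B by rewrite /B trmx_drsub gT.
have a_gt0 : 0 < a.
  have /gpos : delta_mx 0 0 != 0 :> 'rV[F]_(1 + n).
    by apply/eqP => /rowP/(_ 0); rewrite !mxE eqxx; apply/eqP/oner_neq0.
  by rewrite -rowE trmx_delta -colE !mxE.
have a_neq0 := lt0r_neq0 a_gt0.
pose S := B - a^-1 *: (u *m u^T).
have [||P' SE] := IHn S.
- by rewrite linearB /= linearZ /= trmx_mul trmxK BT.
(* The first entry of [v] minimises the quadratic form of [g] for given [w]; the minimum is the form
   of [S] at [w]. *)
- move=> w w_neq0; pose v : 'rV_(1 + n) := row_mx (- a^-1 *: (w *m u)) w.
  have /gpos : v != 0.
    by apply: contraNneq w_neq0 => v0; rewrite -[w](row_mxKr (- a^-1 *: (w *m u))) -/v v0 linear0.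
  suff -> : v *m g *m v^T = w *m S *m w^T by [].
  rewrite gE /v mul_row_block tr_row_mx mul_row_col.
  rewrite mul_mx_scalar scalerA mulrN divff // scaleN1r addNr mul0mx add0r.
  by rewrite -!scalemxAl scaleNr addrC /S mulmxBr -!scalemxAr !mulmxA.
pose r := Num.sqrt a.
have rr : r * r = a by rewrite -expr2 sqr_sqrtr ?ltW.
have r_neq0 : r != 0 by rewrite gt_eqF ?sqrtr_gt0.
exists (block_mx r%:M 0 (r^-1 *: u) P').
rewrite tr_block_mx mulmx_block tr_scalar_mx trmx0 linearZ /= !mul0mx !mulmx0 !addr0.
rewrite -scalar_mxM rr mul_scalar_mx mul_mx_scalar !scalerA divff // !scale1r.
by rewrite -scalemxAl -scalemxAr scalerA -invfM rr -SE /S addrCA subrr addr0.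
Qed.

Lemma posdefmx_unit n (g : 'M[F]_n) : posdefmx g -> g \in unitmx.
Proof.
move=> gpos; rewrite unitmxE unitfE; apply/negP => /det0P[v /gpos + vg].
by rewrite vg mul0mx mxE ltxx.
Qed.

Lemma posdefmx_gram m n (J : 'M[F]_(m, n)) : row_free J -> posdefmx (J *m J^T).
Proof.
move=> Jfree v v_neq0; have vJ : v *m J != 0.
  by apply: contra_neq v_neq0 => vJ; apply: (row_free_inj Jfree); rewrite vJ mul0mx.
rewrite mulmxA -mulmxA -trmx_mul mxE.
have sqE k : true -> (v *m J) 0 k * (v *m J)^T k 0 = (v *m J) 0 k ^+ 2.
  by rewrite [_^T _ _]mxE expr2.
rewrite (eq_bigr _ sqE) lt_def sumr_ge0 ?andbT => [|k _]; last exact: sqr_ge0.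
apply: contra_neq vJ => /psumr_eq0P vJ0; apply/rowP => k; rewrite [RHS]mxE.
by apply/eqP; rewrite -sqrf_eq0 vJ0 // => l _; exact: sqr_ge0.
Qed.

End Cholesky.

(** * Explicit 4x4 algebra: determinant, Pfaffian, dual matrix *)

Local Notation i0 := (@Ordinal 4 0 isT).
Local Notation i1 := (@Ordinal 4 1 isT).
Local Notation i2 := (@Ordinal 4 2 isT).
Local Notation i3 := (@Ordinal 4 3 isT).

Lemma big_ord4 (T : Type) (idx : T) (op : Monoid.law idx) (f : 'I_4 -> T) :
  \big[op/idx]_(i < 4) f i = op (f i0) (op (f i1) (op (f i2) (f i3))).
Proof.
rewrite !big_ord_recl big_ord0 Monoid.mulm1.
by congr (op (f _) (op (f _) (op (f _) (f _)))); apply/val_inj.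
Qed.

(** Serves as an eliminator: the cases come out literally as [i0], ..., [i3], the forms in which the
    entry formulas are stated. *)
Lemma forall_ord4 (P : 'I_4 -> Prop) :
  P i0 -> P i1 -> P i2 -> P i3 -> forall i, P i.
Proof.
move=> P0 P1 P2 P3 [[|[|[|[|//]]]] lt_i4].
- by rewrite (_ : Ordinal _ = i0) //; apply/val_inj.
- by rewrite (_ : Ordinal _ = i1) //; apply/val_inj.
- by rewrite (_ : Ordinal _ = i2) //; apply/val_inj.
- by rewrite (_ : Ordinal _ = i3) //; apply/val_inj.
Qed.

Section Dimension4.
Variable F : comNzRingType.

Lemma det_mx22 (A : 'M[F]_2) : \det A = A 0 0 * A 1 1 - A 0 1 * A 1 0.
Proof.
rewrite (expand_det_row _ 0) !big_ord_recl big_ord0 addr0 /cofactor !det_mx11 !mxE /=.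
rewrite expr0 expr1 mul1r mulN1r mulrN.
by congr (A _ _ * A _ _ - A _ _ * A _ _); apply/val_inj.
Qed.

Lemma det_mx33 (A : 'M[F]_3) (j0 := @Ordinal 3 0 isT) (j1 := @Ordinal 3 1 isT)
    (j2 := @Ordinal 3 2 isT) : \det A =
  A j0 j0 * (A j1 j1 * A j2 j2 - A j1 j2 * A j2 j1)
  - A j0 j1 * (A j1 j0 * A j2 j2 - A j1 j2 * A j2 j0)
  + A j0 j2 * (A j1 j0 * A j2 j1 - A j1 j1 * A j2 j0).
Proof.
rewrite (expand_det_row _ 0) !big_ord_recl big_ord0 addr0 /cofactor !det_mx22 !mxE /=.
rewrite expr0 expr1 sqrrN expr1n !mul1r mulN1r mulrN addrA.
by congr (A _ _ * (A _ _ * A _ _ - A _ _ * A _ _) - A _ _ * (A _ _ * A _ _ - A _ _ * A _ _)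
   + A _ _ * (A _ _ * A _ _ - A _ _ * A _ _)); apply/val_inj.
Qed.

Lemma det_mx44 (A : 'M[F]_4) : \det A =
  A i0 i0 * (A i1 i1 * (A i2 i2 * A i3 i3 - A i2 i3 * A i3 i2)
           - A i1 i2 * (A i2 i1 * A i3 i3 - A i2 i3 * A i3 i1)
           + A i1 i3 * (A i2 i1 * A i3 i2 - A i2 i2 * A i3 i1))
- A i0 i1 * (A i1 i0 * (A i2 i2 * A i3 i3 - A i2 i3 * A i3 i2)
           - A i1 i2 * (A i2 i0 * A i3 i3 - A i2 i3 * A i3 i0)
           + A i1 i3 * (A i2 i0 * A i3 i2 - A i2 i2 * A i3 i0))
+ A i0 i2 * (A i1 i0 * (A i2 i1 * A i3 i3 - A i2 i3 * A i3 i1)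
           - A i1 i1 * (A i2 i0 * A i3 i3 - A i2 i3 * A i3 i0)
           + A i1 i3 * (A i2 i0 * A i3 i1 - A i2 i1 * A i3 i0))
- A i0 i3 * (A i1 i0 * (A i2 i1 * A i3 i2 - A i2 i2 * A i3 i1)
           - A i1 i1 * (A i2 i0 * A i3 i2 - A i2 i2 * A i3 i0)
           + A i1 i2 * (A i2 i0 * A i3 i1 - A i2 i1 * A i3 i0)).
Proof.
have s2 : (-1) ^+ (0 + 2)%N = 1 :> F by rewrite sqrrN expr1n.
have s3 : (-1) ^+ (0 + 3)%N = -1 :> F by rewrite exprS s2 mulr1.
rewrite (expand_det_row _ i0) big_ord4 /cofactor !det_mx33 !mxE.
have -> : lift i0 (@Ordinal 3 0 isT) = i1 by apply/val_inj.
have -> : lift i0 (@Ordinal 3 1 isT) = i2 by apply/val_inj.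
have -> : lift i0 (@Ordinal 3 2 isT) = i3 by apply/val_inj.
have -> : lift i1 (@Ordinal 3 0 isT) = i0 by apply/val_inj.
have -> : lift i1 (@Ordinal 3 1 isT) = i2 by apply/val_inj.
have -> : lift i1 (@Ordinal 3 2 isT) = i3 by apply/val_inj.
have -> : lift i2 (@Ordinal 3 0 isT) = i0 by apply/val_inj.
have -> : lift i2 (@Ordinal 3 1 isT) = i1 by apply/val_inj.
have -> : lift i2 (@Ordinal 3 2 isT) = i3 by apply/val_inj.
have -> : lift i3 (@Ordinal 3 0 isT) = i0 by apply/val_inj.
have -> : lift i3 (@Ordinal 3 1 isT) = i1 by apply/val_inj.
have -> : lift i3 (@Ordinal 3 2 isT) = i2 by apply/val_inj.
rewrite /= s2 s3 expr0 expr1; ring.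
Qed.

Definition pfaffian4 (A : 'M[F]_4) : F :=
  A i0 i1 * A i2 i3 - A i0 i2 * A i1 i3 + A i0 i3 * A i1 i2.

(** For antisymmetric [A] this is the Euclidean Hodge dual, half the contraction of [A] with the
    Levi-Civita symbol, tabulated from the entries above the diagonal. *)
Definition dual4 (A : 'M[F]_4) : 'M[F]_4 := \matrix_(i, j)
  nth 0 (nth [::] [:: [:: 0; A i2 i3; - A i1 i3; A i1 i2];
                      [:: - A i2 i3; 0; A i0 i3; - A i0 i2];
                      [:: A i1 i3; - A i0 i3; 0; A i0 i1];
                      [:: - A i1 i2; A i0 i2; - A i0 i1; 0]] i) j.
End Dimension4.

Section Antisymmetric.
Variables (F : numDomainType) (A : 'M[F]_4).
Hypothesis A_anti : A^T = - A.

Lemma antisym_entry i j : A j i = - A i j.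
Proof. by have /matrixP/(_ i j) := A_anti; rewrite !mxE. Qed.

Lemma antisym_diag i : A i i = 0.
Proof. by apply/eqP; rewrite -eqNr -antisym_entry. Qed.

(** Only pairs i < j are listed, so rewriting moves every entry above the diagonal and cannot
    loop. *)
Definition antisymE :=
  (antisym_diag, antisym_entry i0 i1, antisym_entry i0 i2, antisym_entry i0 i3,
   antisym_entry i1 i2, antisym_entry i1 i3, antisym_entry i2 i3).

Lemma det_antisym4 : \det A = pfaffian4 A ^+ 2.
Proof. rewrite det_mx44 /pfaffian4 !antisymE; ring. Qed.

Lemma mul_dual4 : A *m dual4 A = (- pfaffian4 A)%:M.
Proof.
apply/matrixP.
by elim/forall_ord4; elim/forall_ord4; rewrite !mxE big_ord4 !mxE /= /pfaffian4 !antisymE;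
  ring.
Qed.

End Antisymmetric.

(** * Levi-Civita symbol, Hodge star and the Pfaffian inequality *)

Section Pointwise.
Variable R : realType.
Implicit Types (g w th G T P : 'M[R]_4) (c s : R).

(** In the Leibniz expansion of this 0/1 matrix the term of a permutation survives exactly when the
    permutation agrees with [t]. *)
Lemma levi_civita_det (t : 4.-tuple 'I_4) :
  levi_civita R (tnth t i0) (tnth t i1) (tnth t i2) (tnth t i3) =
    \det (\matrix_(i < 4, j < 4) (tnth t i == j)%:R : 'M[R]_4).
Proof.
rewrite /levi_civita big_mkcond; apply: eq_bigr => s _; rewrite big_ord4 !mxE.
have -> : ([tuple s i | i < 4] ==
           [tuple tnth t i0; tnth t i1; tnth t i2; tnth t i3]) =
    [&& tnth t i0 == s i0, tnth t i1 == s i1, tnth t i2 == s i2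
      & tnth t i3 == s i3].
  apply/eqP/and4P => [E|[/eqP t0 /eqP t1 /eqP t2 /eqP t3]].
    have {}E i : s i = tnth [tuple tnth t i0; tnth t i1; tnth t i2; tnth t i3] i.
      by rewrite -E tnth_mktuple.
    by rewrite !E !(tnth_nth i0) /=.
  apply: eq_from_tnth; elim/forall_ord4; rewrite tnth_mktuple.
  - by rewrite -t0.
  - by rewrite -t1.
  - by rewrite -t2.
  - by rewrite -t3.
by do 4![case: eqP => _]; rewrite /= ?mulr1 ?mulr0 ?mul0r.
Qed.

(* The sign of a permutation is its Vandermonde product, normalised by the value
   12 that this product takes at (0, 1, 2, 3). *)
Lemma levi_civita_vandermonde (a b c d : 'I_4) :
  levi_civita R a b c d =
    ((b%:Z - a%:Z) * (c%:Z - a%:Z) * (d%:Z - a%:Z)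
      * (c%:Z - b%:Z) * (d%:Z - b%:Z) * (d%:Z - c%:Z))%:~R / 12.
Proof.
pose t := [tuple a; b; c; d].
(* Integer entries make the identity decidable by computation, over all 256 index quadruples. *)
have -> : levi_civita R a b c d =
    \det (map_mx intr (\matrix_(i < 4, j < 4) (tnth t i == j)%:R : 'M[int]_4)).
  rewrite (levi_civita_det t); congr (\det _).
  by apply/matrixP => i j; rewrite !mxE rmorph_nat.
rewrite det_map_mx; apply: canRL (mulfK _) _; first by rewrite pnatr_eq0.
rewrite -[12]/(12%:Z%:~R) -rmorphM /=; congr (_%:~R).
rewrite det_mx44 !mxE !(tnth_nth i0) /= {t}.
by move: a b c d; do 4!elim/forall_ord4; vm_compute.
Qed.

(** The factor 2 arises because (r, k) and (k, r) contribute equally: the symbol and [Y] both change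
    sign. *)
Lemma levi_civita_dual4 (Y : 'M[R]_4) (mu nu : 'I_4) : Y^T = - Y ->
  \sum_(r < 4) \sum_(k < 4) levi_civita R mu nu r k * Y r k = 2 * dual4 Y mu nu.
Proof.
move=> Ya; rewrite !big_ord4 /= !levi_civita_vandermonde !mxE !(antisymE Ya).
by move: mu nu; elim/forall_ord4; elim/forall_ord4 => /=; field.
Qed.

(** Raising both indices of [w] gives an antisymmetric matrix, and the factor 2 of
    [levi_civita_dual4] cancels the 1/2 in the star. *)
Lemma hodge2E g w : g^T = g -> w^T = - w ->
  hodge2 g w = Num.sqrt (\det g) *: dual4 (invmx g *m w *m invmx g).
Proof.
move=> gT wT; have giT : (invmx g)^T = invmx g by rewrite trmx_inv gT.
have Ya : (invmx g *m w *m invmx g)^T = - (invmx g *m w *m invmx g).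
  by rewrite !trmx_mul giT wT mulNmx mulmxN mulmxA.
apply/matrixP => mu nu; rewrite !mxE.
transitivity (2^-1 * Num.sqrt (\det g) * (2 * dual4 (invmx g *m w *m invmx g) mu nu)); last first.
  by rewrite !mxE; field.
congr (_ * _); rewrite -levi_civita_dual4 //.
apply: eq_bigr => r _; apply: eq_bigr => k _.
rewrite mxE mulr_sumr exchange_big; apply: eq_bigr => b _ /=.
rewrite mxE mulr_suml mulr_sumr; apply: eq_bigr => a _.
by rewrite -{2}giT mxE; ring.
Qed.

Lemma frobenius_ge_pfaffian T c : T^T = - T -> 0 < c -> (c * pfaffian4 T) ^+ 2 = 1 ->
  4 <= c * \tr (T *m T^T) /\
  (c * \tr (T *m T^T) = 4 -> c *: (T *m T^T) = 1%:M).
Proof.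
move=> Ta c_gt0 /eqP; rewrite sqrf_eq1.
have trE : \tr (T *m T^T) = 2 * (T i0 i1 ^+ 2 + T i0 i2 ^+ 2 + T i0 i3 ^+ 2
    + T i1 i2 ^+ 2 + T i1 i3 ^+ 2 + T i2 i3 ^+ 2).
  by rewrite /mxtrace !big_ord4 !mxE !big_ord4 !mxE /= !(antisymE Ta); ring.
rewrite trE => /orP pf1.
(* [e] is the sign of Pf T, so that [e * pfaffian4 T] replaces the absolute value. *)
have [e [e2 cpf]] : exists e : R, e ^+ 2 = 1 /\ c * pfaffian4 T = e.
  by case: pf1 => /eqP->; [exists 1 | exists (-1)]; split => //; rewrite ?sqrrN expr1n.
(* The squared terms are the first-row entries of [T - e *: dual4 T]; hence [S] vanishes only if [T]
   is [e] times its dual. *)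
pose S := (T i0 i1 - e * T i2 i3) ^+ 2 + (T i0 i2 + e * T i1 i3) ^+ 2
  + (T i0 i3 - e * T i1 i2) ^+ 2.
have cS : c * (2 * (T i0 i1 ^+ 2 + T i0 i2 ^+ 2 + T i0 i3 ^+ 2
    + T i1 i2 ^+ 2 + T i1 i3 ^+ 2 + T i2 i3 ^+ 2)) = 4 + 2 * (c * S).
  have -> : 4 = 4 * (e * (c * pfaffian4 T)) by rewrite cpf -expr2 e2 mulr1.
  by rewrite /S /pfaffian4; ring: e2.
rewrite cS; split.
  by rewrite lerDl !mulr_ge0 ?ler0n ?(ltW c_gt0) // !addr_ge0 ?sqr_ge0.
move=> S4; have {S4} : S == 0.
  have : 2 * (c * S) == 0 by rewrite -(inj_eq (addrI 4)) S4 addr0.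
  by rewrite !mulf_eq0 pnatr_eq0 (gt_eqF c_gt0).
rewrite !paddr_eq0 ?addr_ge0 ?sqr_ge0 // !sqrf_eq0 subr_eq0 addr_eq0 subr_eq0.
move=> /andP[/andP[/eqP T01 /eqP T02] /eqP T03].
(* Once the first row is eliminated, this sum of squares is the common diagonal entry of
   [T *m T^T]. *)
have cN : c * (T i2 i3 ^+ 2 + T i1 i3 ^+ 2 + T i1 i2 ^+ 2) = 1.
  have S0 : S = 0 by rewrite /S T01 T02 T03; ring.
  have cN4 : 4 * (c * (T i2 i3 ^+ 2 + T i1 i3 ^+ 2 + T i1 i2 ^+ 2)) = 4 * 1.
    by move: cS; rewrite S0 T01 T02 T03 !mulr0 addr0 mulr1; apply: etrans; ring: e2.
  by apply: mulfI cN4; rewrite pnatr_eq0.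
apply/matrixP; elim/forall_ord4; elim/forall_ord4.
all: rewrite !mxE !big_ord4 !mxE /= !(antisymE Ta) ?T01 ?T02 ?T03 /= ?mulr1n ?mulr0n.
all: by [ring: e2 | apply: etrans cN; ring: e2].
Qed.

(** * The effective metric at a single point *)

Section EffectiveMetric.
Variables (g th G P : 'M[R]_4) (s : R).
Hypotheses (gE : g = P *m P^T) (g_unit : g \in unitmx).
Hypotheses (th_anti : th^T = - th) (th_unit : th \in unitmx).
Hypothesis effG : is_effective_metric g th G s.

Let c := expR (- s).
Let c_gt0 : 0 < c := expR_gt0 (- s).
(** The components of theta in the g-orthonormal coframe given by the columns of [P]. *)
Let T := P^T *m th *m P.

Let gT : g^T = g. Proof. by rewrite gE trmx_mul trmxK. Qed.

Let T_anti : T^T = - T.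
Proof. by rewrite /T !trmx_mul trmxK th_anti mulNmx mulmxN mulmxA. Qed.

Lemma effective_inverse : invmx G = c *: (th *m g *m th^T).
Proof.
have [_ GE _] := effG; apply/matrixP => mu nu; rewrite GE !mxE; congr (_ * _).
rewrite exchange_big; apply: eq_bigr => k _ /=.
rewrite !mxE mulr_suml; apply: eq_bigr => r _; ring.
Qed.

Lemma effective_density : c ^+ 2 * (\det th * \det G) = 1.
Proof.
have [G_unit _] := effG; rewrite -/c /symplectic_density det_inv => cE.
have detG0 : \det G != 0 by rewrite -unitfE.
have detth0 : \det th != 0 by rewrite -unitfE.
have detth_ge0 : 0 <= \det th by rewrite (det_antisym4 th_anti) sqr_ge0.
(* A negative determinant would have square root 0 by convention, and division by 0 would then give
   c = 0. *)
have detG_ge0 : 0 <= \det G.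
  case: (lerP 0 (\det G)) => // /ltW /ler0_sqrtr detG_neg.
  by have := c_gt0; rewrite cE detG_neg invr0 mulr0 ltxx.
by rewrite cE exprMn exprVn !sqr_sqrtr ?invr_ge0 //; field; rewrite detth0 detG0.
Qed.

(** Determinants in [effective_inverse] produce c^4 det(theta)^2 det(g). In dimension 4 the power
    c^4 is exactly what two uses of [effective_density] absorb. *)
Lemma det_effective : \det G = \det g.
Proof.
have [G_unit _ _] := effG; have detG0 : \det G != 0 by rewrite -unitfE.
have := congr1 determinant effective_inverse.
rewrite det_inv detZ !det_mulmx det_tr => detE.
have <- : \det G * \det G * (\det G)^-1 = \det G by rewrite mulfK.
rewrite detE; transitivity ((c ^+ 2 * (\det th * \det G)) ^+ 2 * \det g); first ring.
by rewrite effective_density expr1n mul1r.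
Qed.

Let detg0 : \det g != 0. Proof. by rewrite -unitfE. Qed.
Let detth0 : \det th != 0. Proof. by rewrite -unitfE. Qed.

Lemma effective_pfaffian : (c * pfaffian4 T) ^+ 2 = 1.
Proof.
rewrite exprMn -(det_antisym4 T_anti) /T !det_mulmx -effective_density det_effective gE.
rewrite det_mulmx; ring.
Qed.

Lemma contract_trace : mx_contract G g = c * \tr (th *m g *m th^T *m g).
Proof.
transitivity (\tr (invmx G *m g^T)).
  by rewrite /mx_contract; apply: eq_bigr => mu _; rewrite mxE;
    apply: eq_bigr => nu _; rewrite mxE.
by rewrite effective_inverse gT -scalemxAl mxtraceZ.
Qed.

Lemma contract_frobenius : mx_contract G g = c * \tr (T *m T^T).
Proof.
rewrite contract_trace; congr (_ * _).
rewrite /T !trmx_mul trmxK [in RHS]mulmxA -[in RHS]mulmxA [RHS]mxtrace_mulC gE.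
by rewrite !mulmxA mxtrace_mulC !mulmxA.
Qed.

Lemma contract_ge4 : 4 <= mx_contract G g.
Proof.
rewrite contract_frobenius.
by have [] := frobenius_ge_pfaffian T_anti c_gt0 effective_pfaffian.
Qed.

(** Multiply [effective_inverse] by [g] on the left and by [invmx th] on the right; the minus sign
    comes from the antisymmetry of theta. *)
Lemma effective_eq : G = g <-> c *: (g *m th *m g) = - invmx th.
Proof.
split=> [Gg | E].
  have : g *m invmx G *m invmx th = invmx th by rewrite Gg mulmxV // mul1mx.
  rewrite effective_inverse th_anti mulmxN scalerN mulmxN mulNmx.
  rewrite -!scalemxAr -!scalemxAl !mulmxA mulmxK // => <-.
  by rewrite opprK.
have gG : g *m invmx G = 1%:M.
  rewrite effective_inverse th_anti mulmxN scalerN mulmxN -scalemxAr !mulmxA.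
  by rewrite scalemxAl E mulNmx opprK mulVmx.
have : invmx G = invmx g by rewrite -[LHS](mulKmx g_unit) gG mulmx1.
by move/(congr1 invmx); rewrite !invmxK.
Qed.

Lemma contract_eq4 : mx_contract G g = 4 <-> G = g.
Proof.
split=> [|Gg]; last first.
  have [G_unit _ _] := effG.
  transitivity (\tr (invmx G *m G^T)).
    by rewrite -Gg /mx_contract; apply: eq_bigr => mu _; rewrite mxE;
      apply: eq_bigr => nu _; rewrite mxE.
  by rewrite [in X in \tr (_ *m X)]Gg gT -Gg mulVmx // mxtrace1.
have [_ eq4] := frobenius_ge_pfaffian T_anti c_gt0 effective_pfaffian.
rewrite contract_frobenius => /eq4 TT.
have P_unit : P \in unitmx by move: g_unit; rewrite gE unitmx_mul => /andP[].
have Gg1 : invmx G *m g = 1%:M.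
  rewrite effective_inverse -scalemxAl [X in _ *m X]gE.
  (* Conjugation by [P^T] leads back from the orthonormal frame to the coordinates. *)
  have -> : th *m g *m th^T *m (P *m P^T) = invmx P^T *m (T *m T^T) *m P^T.
    by rewrite /T !trmx_mul trmxK gE !mulmxA mulVmx ?unitmx_tr // mul1mx.
  by rewrite scalemxAl scalemxAr TT mulmx1 mulVmx // unitmx_tr.
have [G_unit _ _] := effG.
by rewrite -[g](mulKVmx G_unit) Gg1 mulmx1.
Qed.

(** Multiplying by theta and taking traces would equate 4 with - c tr(T T^T), which is at most
    -4. *)
Lemma effective_neq : c *: (g *m th *m g) <> invmx th.
Proof.
move/(congr1 (mulmx^~ th)); rewrite mulVmx // => E.
have := contract_ge4; rewrite contract_frobenius.
suff -> : c * \tr (T *m T^T) = - \tr (c *: (g *m th *m g) *m th).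
  by rewrite E mxtrace1; lra.
rewrite T_anti mulmxN raddfN /= mulrN -scalemxAl mxtraceZ; congr (- (_ * _)).
by rewrite /T gE -!mulmxA [LHS]mxtrace_mulC !mulmxA [RHS]mxtrace_mulC !mulmxA.
Qed.

(** [Y], which is omega with raised indices, is the inverse of g theta g, so by [mul_dual4] its dual
    is - Pf(Y) g theta g. Only the square of [q] is fixed: its sign separates the self-dual from the
    anti-self-dual case. *)
Lemma hodge_inverse : exists2 q, q ^+ 2 = c ^+ 2 &
  hodge2 g (invmx th) = q *: (g *m th *m g).
Proof.
have w_anti : (invmx th)^T = - invmx th.
  apply: (can_inj (mulKmx th_unit)); rewrite mulmxN mulmxV // -[X in X *m _]opprK.
  by rewrite -th_anti mulNmx -trmx_mul mulVmx // trmx1.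
pose Y := invmx g *m invmx th *m invmx g.
have Y_anti : Y^T = - Y.
  by rewrite /Y !trmx_mul trmx_inv gT w_anti mulNmx mulmxN mulmxA.
exists (- Num.sqrt (\det g) * pfaffian4 Y).
  rewrite exprMn sqrrN sqr_sqrtr; last by rewrite gE det_mulmx det_tr -expr2 sqr_ge0.
  have -> : c ^+ 2 = (\det th * \det g)^-1.
    rewrite -[LHS](mulfK (mulf_neq0 detth0 detg0)) -{1}det_effective effective_density.
    by rewrite mul1r.
  by rewrite -(det_antisym4 Y_anti) /Y !det_mulmx !det_inv; field; rewrite detg0.
have YK : g *m th *m g *m Y = 1%:M.
  by rewrite /Y !mulmxA mulmxK // mulmxK // mulmxV.
rewrite hodge2E // -/Y -[dual4 Y]mul1mx -YK.
rewrite -(mulmxA (g *m th *m g) Y) (mul_dual4 Y_anti).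
by rewrite mul_mx_scalar scalerA mulrN mulNr.
Qed.

(** By [effective_eq], G = g means anti-self-duality when q = c and self-duality when q = -c;
    [effective_neq] rules out the other alternative each time. *)
Lemma effective_self_dual : G = g <->
  hodge2 g (invmx th) = invmx th \/ hodge2 g (invmx th) = - invmx th.
Proof.
have [q /eqP] := hodge_inverse; rewrite eqf_sqr => /orP[]/eqP-> ->.
  rewrite effective_eq; split; first by right.
  by case=> // /effective_neq.
rewrite effective_eq scaleNr; split=> [->|]; first by left; rewrite opprK.
by case=> [<-|/oppr_inj/effective_neq //]; rewrite opprK.
Qed.

End EffectiveMetric.

End Pointwise.

(** * Induced metric and Lagrangian in a chart *)

Section Geometry.
Variables (R : realType) (D : nat) (M : oriented_submanifold R D).
Variables (i : nat) (u : 'rV[R]_4).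
Hypothesis dom_u : chart_dom M i u.
Let J := 'J (chart_emb M i) u.

Let emb_diff : differentiable (chart_emb M i) u.
(* The empty list of derivatives in [smooth_on] gives differentiability of the embedding itself. *)
Proof. exact: (@emb_smooth _ _ M i [::] u dom_u). Qed.

Lemma partial_emb mu a : partial mu (chart_emb M i) u 0 a = J mu a.
Proof. by rewrite /partial deriveEjacobian // -rowE mxE. Qed.

Lemma partial_emb_coord mu a : partial mu (fun v => chart_emb M i v 0 a) u = J mu a.
Proof.
rewrite -partial_emb /partial [in RHS]derive_mx; first by rewrite mxE.
exact: diff_derivable.
Qed.

Lemma induced_metric_gram : induced_metric M i u = J *m J^T.
Proof.
apply/matrixP => mu nu; rewrite mxE [RHS]mxE; apply: eq_bigr => a _.
rewrite (bigD1 a) //= big1 ?addr0 => [|b b_neq]; last first.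
  by rewrite eq_sym (negbTE b_neq) mulr0.
by rewrite eqxx mulr1 !partial_emb [J^T _ _]mxE.
Qed.

Lemma induced_metric_posdef : posdefmx (induced_metric M i u).
Proof.
rewrite induced_metric_gram; apply: posdefmx_gram.
by rewrite /row_free emb_immersion.
Qed.

Lemma induced_metric_square :
  exists P : 'M[R]_4, induced_metric M i u = P *m P^T.
Proof.
apply: cholesky induced_metric_posdef.
by rewrite induced_metric_gram trmx_mul trmxK.
Qed.

Variables (th G : mx_field R) (sigma : scalar_field R).
Hypotheses (th_poisson : nondegenerate_poisson M th).
Hypothesis effG : effective_metric M th G sigma.

Lemma eta_contract : expR (- sigma i u) * eta_fun M G sigma i u =
  4^-1 * mx_contract (G i u) (induced_metric M i u).
Proof.
by rewrite mulrA mulrCA -expRD addNr expR0 mulr1.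
Qed.

(** The brackets {x^a, x^b} are the entries of J^T theta J. Their sum of squares is a trace, which
    cycles to tr(theta g theta^T g), and the factor e^sigma in eta cancels the e^-sigma of the
    contraction. *)
Lemma ym_lagrangian_eta : ym_lagrangian M th i u = eta_fun M G sigma i u.
Proof.
have [P gE] := induced_metric_square.
rewrite /eta_fun (contract_trace gE (effG dom_u)) /ym_lagrangian -!mulrA; congr (_ * _).
rewrite mulrA -expRD subrr expR0 mul1r.
transitivity (\tr ((J^T *m th i u *m J) *m (J^T *m th i u *m J)^T)).
  apply: eq_bigr => a _; rewrite mxE; apply: eq_bigr => b _; rewrite [_^T _ _]mxE -expr2.
  congr (_ ^+ 2); rewrite /poisson_bracket mxE exchange_big.
  apply: eq_bigr => nu _; rewrite mxE mulr_suml; apply: eq_bigr => mu _ /=.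
  by rewrite !partial_emb_coord [J^T _ _]mxE; ring.
rewrite induced_metric_gram !trmx_mul trmxK -!mulmxA.
by rewrite [LHS]mxtrace_mulC !mulmxA.
Qed.

Lemma pointwise_bound :
  let g := induced_metric M in
  [/\ expR (- sigma i u) * eta_fun M G sigma i u
        = 4^-1 * mx_contract (G i u) (g i u),
      1 <= expR (- sigma i u) * eta_fun M G sigma i u,
      expR (- sigma i u) * eta_fun M G sigma i u = 1 <-> G i u = g i u
    & G i u = g i u <->
      self_dual_at M th i u \/ anti_self_dual_at M th i u].
Proof.
have [P gE] := induced_metric_square; have gU := posdefmx_unit induced_metric_posdef.
have thA := poisson_anti th_poisson dom_u; have thU := poisson_nondeg th_poisson dom_u.
have eff := effG dom_u; rewrite eta_contract; split => //.
- by rewrite ler_pdivlMl // mulr1; exact: contract_ge4 gE thA thU eff.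
- rewrite -(contract_eq4 gE gU thA thU eff); split=> [|->]; last by rewrite mulVf.
  by move/(canRL (mulVKf _)) => ->; rewrite ?mulr1.
- exact: effective_self_dual gE gU thA thU eff.
Qed.

Lemma effective_metric_det : \det (G i u) = \det (induced_metric M i u).
Proof.
apply: det_effective _ _ (effG dom_u); first exact: (poisson_anti th_poisson dom_u).
exact: (poisson_nondeg th_poisson dom_u).
Qed.

End Geometry.

(** * Comparison of the actions *)

Section Action.
Variable R : realType.

(* Neither [A] nor the functions need be measurable here, since the integral of a
   nonnegative function is a supremum over the simple functions below it. *)
Lemma ge0_le_integral_nomeas d (T : measurableType d)
    (mu : {measure set T -> \bar R}) (A : set T) (f1 f2 : T -> \bar R) :
  (forall x, A x -> 0 <= f1 x)%E -> (forall x, A x -> f1 x <= f2 x)%E ->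
  (\int[mu]_(x in A) f1 x <= \int[mu]_(x in A) f2 x)%E.
Proof.
move=> f10 f12; have f20 x : A x -> (0 <= f2 x)%E.
  by move=> Ax; apply: le_trans (f12 x Ax); exact: f10.
rewrite !ge0_integralE //; apply: le_ereal_sup => _ [h hf <-]; exists h => // x.
by apply: le_trans (hf x) _; exact: lee_restrict.
Qed.

Variables (D : nat) (M : oriented_submanifold R D).

Lemma eq_integral_density (f h : scalar_field R) :
  (forall i u, chart_dom M i u -> f i u = h i u) ->
  integral_density M f = integral_density M h.
Proof.
move=> fh; apply: eq_eseriesr => i _; apply: eq_integral => p.
by rewrite inE => -[dom_p _]; rewrite fh.
Qed.

Lemma le_integral_density (f h : scalar_field R) :
  (forall i u, chart_dom M i u -> 0 <= f i u) ->
  (forall i u, chart_dom M i u -> f i u <= h i u) ->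
  (integral_density M f <= integral_density M h)%E.
Proof.
move=> f0 fh; apply: lee_nneseries => i _.
  by move=> _; apply: integral_ge0 => p [dom_p _]; rewrite lee_fin f0.
apply: ge0_le_integral_nomeas => p [dom_p _]; rewrite lee_fin; [exact: f0|exact: fh].
Qed.

Variables (th G : mx_field R) (sigma : scalar_field R).
Hypothesis effG : effective_metric M th G sigma.

Lemma S_YM_eta : S_YM M th G sigma = integral_density M (fun i u =>
  ((2 * pi) ^+ 2)^-1 * Num.sqrt (\det (G i u))
    * (expR (- sigma i u) * eta_fun M G sigma i u)).
Proof.
apply: eq_integral_density => i u dom_u.
by rewrite (ym_lagrangian_eta dom_u effG) [RHS]mulrA.
Qed.

End Action.

Theorem mainTheorem1 (R : realType) (D : nat) (M : oriented_submanifold R D) :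
  (forall (th G : mx_field R) (sigma : scalar_field R),
     nondegenerate_poisson M th -> effective_metric M th G sigma ->
     (forall (i : nat) (u : 'rV[R]_4), chart_dom M i u ->
        let g := induced_metric M in
        [/\ expR (- sigma i u) * eta_fun M G sigma i u
              = 4^-1 * mx_contract (G i u) (g i u),
            1 <= expR (- sigma i u) * eta_fun M G sigma i u,
            expR (- sigma i u) * eta_fun M G sigma i u = 1 <-> G i u = g i u
          & G i u = g i u <->
            self_dual_at M th i u \/ anti_self_dual_at M th i u])
     /\ S_YM M th G sigma = integral_density M (fun i u =>
          ((2 * pi) ^+ 2)^-1 * Num.sqrt (\det (G i u))
            * (expR (- sigma i u) * eta_fun M G sigma i u)))
  /\
  (forall (th0 G0 : mx_field R) (sigma0 : scalar_field R),
     nondegenerate_poisson M th0 -> effective_metric M th0 G0 sigma0 ->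
     (forall (i : nat) (u : 'rV[R]_4), chart_dom M i u ->
        self_dual_at M th0 i u \/ anti_self_dual_at M th0 i u)
     \/ (forall (i : nat) (u : 'rV[R]_4), chart_dom M i u ->
           G0 i u = induced_metric M i u) ->
     forall (th G : mx_field R) (sigma : scalar_field R),
       nondegenerate_poisson M th -> effective_metric M th G sigma ->
       (S_YM M th0 G0 sigma0 <= S_YM M th G sigma)%E).
Proof.
split=> [th G sigma th_poisson effG|th0 G0 sigma0 th0_poisson effG0 minimal th G sigma th_poisson effG].
  split=> [i u dom_u|]; [exact: pointwise_bound|exact: S_YM_eta].
have G0g i u : chart_dom M i u -> G0 i u = induced_metric M i u.
  move=> dom_u; case: minimal => [dual|]; last exact.
  by have [_ _ _ ->] := pointwise_bound dom_u th0_poisson effG0; exact: dual.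
rewrite (S_YM_eta effG0) (S_YM_eta effG).
have pos (x : R) : 0 <= ((2 * pi) ^+ 2)^-1 * Num.sqrt x.
  by rewrite mulr_ge0 ?sqrtr_ge0 // invr_ge0 sqr_ge0.
apply: le_integral_density => i u dom_u.
all: have [_ ge1 eq1 _] := pointwise_bound dom_u th0_poisson effG0.
  by rewrite mulr_ge0 ?pos // (le_trans ler01 ge1).
have [_ ge1' _ _] := pointwise_bound dom_u th_poisson effG.
(* Both determinants equal det g, so the two densities share a prefactor fixed by the embedding, and
   it remains to compare 1 with e^-sigma eta. *)
by rewrite eq1.2 ?G0g // (effective_metric_det dom_u th_poisson effG) ler_wpM2l ?pos.
Qed.
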